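(* Suppose that the matrix $Q$ is indefinite. For $\alpha_g\ge0$, denote by $\mu_{\mathrm{GEIG}}(\alpha_g)$ the optimal objective function value of $$\min_{x\in\mathcal X}\ x^T\big(Q+\alpha_g(I_n+A^TA)\big)x+\big(q-\alpha_g(l+u+2A^Tb)\big)^Tx+\alpha_g(l^Tu+b^Tb),$$ and denote by $\mu_{\mathrm{SDP\_GEIG}}$ the optimal objective function value of $$\min_{x\in\mathcal X,\;X\in\mathbb S^n}\ \langle Q,X\rangle+q^Tx\quad\text{s.t.}\quad X-xx^T\succcurlyeq0,\quad \langle I_n,X\rangle-(l+u)^Tx+l^Tu+\langle A^TA,X\rangle-(2A^Tb)^Tx+b^Tb\le0.$$ Then the following hold: (i) If $\alpha_g\ge-\lambda_{\min}(Q,I_n+A^TA)$, then $\mu_{\mathrm{GEIG}}(\alpha_g)\le\mu_{\mathrm{SDP\_GEIG}}$. (ii) If $\alpha_g=-\lambda_{\min}(Q,I_n+A^TA)$, then $\mu_{\mathrm{GEIG}}(\alpha_g)=\mu_{\mathrm{SDP\_GEIG}}$.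
   Context: $Q\in\mathbb R^{n\times n}$ is symmetric, $q\in\mathbb R^n$, and $\mathcal X=\{x\in\mathbb R^n: Ax=b,\ Cx\le d,\ l\le x\le u\}$ with $A\in\mathbb R^{m\times n}$, $b\in\mathbb R^m$, $C\in\mathbb R^{p\times n}$, $d\in\mathbb R^p$, and finite bounds $-\infty<l_i<u_i<\infty$ for all $i$. $\mathbb S^n$ is the set of real symmetric $n\times n$ matrices, $\langle M,P\rangle=\sum_{i,j}M_{ij}P_{ij}$, $M\succcurlyeq0$ means positive semidefinite, $I_n$ is the identity. For $M,N\in\mathbb S^n$ with $N\succ0$ (positive definite), $\lambda_{\min}(M,N)$ is the smallest generalized eigenvalue of $Mv=\lambda Nv$, i.e. $\lambda_{\min}(M,N)=\min_{x\ne0}\frac{x^TMx}{x^TNx}$. *)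

(* Defs.v *)
From HB Require Import structures.
From mathcomp Require Import all_boot all_order all_algebra.
From mathcomp Require Import boolp classical_sets reals ereal.

Set Implicit Arguments.
Unset Strict Implicit.
Unset Printing Implicit Defensive.

Import Order.TTheory GRing.Theory Num.Theory.
Local Open Scope classical_set_scope.
Local Open Scope ring_scope.

Section Matrices.
Variable R : realType.

Definition dot n (x y : 'cV[R]_n) : R := (x^T *m y) 0 0.

Definition qform n (M : 'M[R]_n) (x : 'cV[R]_n) : R := (x^T *m M *m x) 0 0.

Definition mxdot n (M P : 'M[R]_n) : R := \sum_i \sum_j M i j * P i j.

Definition psdmx n (M : 'M[R]_n) : Prop :=
  M \is symmetricmx /\ forall x : 'cV[R]_n, 0 <= qform M x.

Definition indefinite n (M : 'M[R]_n) : Prop :=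
  [/\ M \is symmetricmx, ~ psdmx M & ~ psdmx (- M)].

Definition gen_eigenvalue n (M N : 'M[R]_n) (a : R) : Prop :=
  exists2 v : 'cV[R]_n, v != 0 & M *m v = a *: (N *m v).

(* Meaningful for n > 0, M symmetric and N symmetric positive definite: the
   set is then finite and nonempty, so that its infimum is its least element. *)
Definition lambda_min n (M N : 'M[R]_n) : R :=
  inf [set a | gen_eigenvalue M N a].

End Matrices.

(* The optimal value of min {f z | z in S}; it is +oo if S is empty. *)
Definition optval (R : realType) T (S : set T) (f : T -> R) : \bar R :=
  ereal_inf [set (f z)%:E | z in S].

Section Problems.
Variables (R : realType) (n m p : nat).
Variables (Q : 'M[R]_n) (q : 'cV[R]_n) (A : 'M[R]_(m, n)) (b : 'cV[R]_m).
Variables (C : 'M[R]_(p, n)) (d : 'cV[R]_p) (l u : 'cV[R]_n).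

Definition feasible : set 'cV[R]_n :=
  [set x | [/\ A *m x = b,
               forall k, (C *m x) k 0 <= d k 0 &
               forall i, l i 0 <= x i 0 <= u i 0]].

Definition mu_GEIG (alpha : R) : \bar R :=
  optval feasible (fun x =>
    qform (Q + alpha *: (1%:M + A^T *m A)) x
    + dot (q - alpha *: (l + u + 2%:R *: (A^T *m b))) x
    + alpha * (dot l u + dot b b)).

Definition SDP_feasible : set ('cV[R]_n * 'M[R]_n) :=
  [set xX | let: (x, X) := xX in
    [/\ feasible x,
        X \is symmetricmx,
        psdmx (X - x *m x^T) &
        mxdot 1%:M X - dot (l + u) x + dot l u
        + mxdot (A^T *m A) X - dot (2%:R *: (A^T *m b)) x + dot b b <= 0]].

Definition mu_SDP_GEIG : \bar R :=
  optval SDP_feasible (fun xX => mxdot Q xX.2 + dot q xX.1).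

End Problems.

(* Main.v *)
Require Import Defs.
From HB Require Import structures.
From mathcomp Require Import all_boot all_order all_algebra.
From mathcomp Require Import boolp classical_sets reals ereal.
From mathcomp Require Import ring lra.

Set Implicit Arguments.
Unset Strict Implicit.
Unset Printing Implicit Defensive.

Import Order.TTheory GRing.Theory Num.Theory.
Local Open Scope ring_scope.

(** The inequality defining the relaxation is a surrogate: with
    N = 1 + A^T A it adds the n inequalities (x_i - l_i)(x_i - u_i) <= 0 and
    the equation |A x - b|^2 = 0, all linearised through X = x x^T.  Taking it
    into the objective with a multiplier a >= 0 gives the identity
    [lagrangianE]
      <Q, X> + q.x + a surrogate(x, X)
        = convexified a x + <Q + a N, X - x x^T>,
    where [convexified a] is the objective of the first problem.

    If a >= - lambda_min(Q, N) then Q + a N is positive semidefinite, so both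
    a surrogate(x, X) <= 0 and <Q + a N, X - x x^T> >= 0 at a point of the
    relaxation, the latter because the cone of positive semidefinite matrices
    is self-dual ([mxdot_psd_ge0]).  Hence the objective of the relaxation
    dominates [convexified a], which is (i).

    If a = - lambda_min(Q, N), then Q + a N has moreover a kernel vector
    v != 0.  Given x in the feasible set, moving from X = x x^T along v v^T
    leaves <Q + a N, X - x x^T> equal to 0 but increases the surrogate, which
    is nonpositive at x x^T; it can thus be driven exactly to 0, and there the
    identity says that the two objectives agree.  This gives the converse
    inequality of (ii).

    Both parts rest on the variational description of lambda_min
    ([lambda_minP]): M - lambda_min(M, N) N is positive semidefinite and
    lambda_min(M, N) is an eigenvalue.  It is obtained without the spectral
    theorem or compactness: let s be the supremum of the a for which M - a N
    is positive semidefinite.  The form of M - s N is a limit of nonnegative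
    forms, and were M - s N invertible it would be coercive
    ([psd_unit_coercive]), so that s could still be increased.  Hence s is a
    generalized eigenvalue, and it is a lower bound of all the others. *)

(** * Bilinear and quadratic forms *)

Section PositiveSemidefinite.
Variables (R : realType) (n : nat).
Implicit Types (M N P S : 'M[R]_n) (x y z : 'cV[R]_n).

Definition bform M x y : R := (x^T *m M *m y) 0 0.

Lemma qform_bform M x : qform M x = bform M x x.
Proof. by []. Qed.

Lemma symmetricmxP M : reflect (M^T = M) (M \is symmetricmx).
Proof.
rewrite is_hermitianmxE expr0 scale1r map_mx_id //.
by apply: (iffP eqP) => /esym.
Qed.

Lemma bformDr M x y z : bform M x (y + z) = bform M x y + bform M x z.
Proof. by rewrite /bform mulmxDr mxE. Qed.

Lemma bformDl M x y z : bform M (x + y) z = bform M x z + bform M y z.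
Proof. by rewrite /bform linearD /= !mulmxDl mxE. Qed.

Lemma bformZr M a x y : bform M x (a *: y) = a * bform M x y.
Proof. by rewrite /bform -scalemxAr mxE. Qed.

Lemma bformZl M a x y : bform M (a *: x) y = a * bform M x y.
Proof. by rewrite /bform linearZ /= -!scalemxAl mxE. Qed.

Lemma bformC M x y : M \is symmetricmx -> bform M x y = bform M y x.
Proof.
move=> /symmetricmxP symM; rewrite /bform.
have -> : (x^T *m M *m y) 0 0 = (x^T *m M *m y)^T 0 0 by rewrite [RHS]mxE.
by rewrite !trmx_mul trmxK symM mulmxA.
Qed.

Lemma bform_dot M x y : bform M x y = dot x (M *m y).
Proof. by rewrite /bform /dot mulmxA. Qed.

Lemma dotE (k : nat) (x y : 'cV[R]_k) : dot x y = \sum_i x i 0 * y i 0.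
Proof. by rewrite /dot mxE; apply: eq_bigr => i _; rewrite mxE. Qed.

Lemma dotC (k : nat) (x y : 'cV[R]_k) : dot x y = dot y x.
Proof. by rewrite !dotE; apply: eq_bigr => i _; rewrite mulrC. Qed.

Lemma dotDl (k : nat) (x y z : 'cV[R]_k) : dot (x + y) z = dot x z + dot y z.
Proof. by rewrite /dot linearD mulmxDl mxE. Qed.

Lemma dotZl (k : nat) a (x y : 'cV[R]_k) : dot (a *: x) y = a * dot x y.
Proof. by rewrite /dot linearZ -scalemxAl mxE. Qed.

Lemma bformE M x y : bform M x y = \sum_i \sum_j M i j * (x i 0 * y j 0).
Proof.
rewrite bform_dot dotE; apply: eq_bigr => i _.
rewrite mxE mulr_sumr; apply: eq_bigr => j _; ring.
Qed.

Lemma bform_delta M i j : bform M (delta_mx i 0) (delta_mx j 0) = M i j.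
Proof. by rewrite /bform trmx_delta -rowE -colE !mxE. Qed.

Lemma qformB M N x : qform (M - N) x = qform M x - qform N x.
Proof. by rewrite /qform mulmxBr mulmxBl !mxE. Qed.

Lemma qformD M N x : qform (M + N) x = qform M x + qform N x.
Proof. by rewrite /qform mulmxDr mulmxDl !mxE. Qed.

Lemma qformZ a M x : qform (a *: M) x = a * qform M x.
Proof. by rewrite /qform -scalemxAr -scalemxAl mxE. Qed.

Lemma dot_ge0 (k : nat) (x : 'cV[R]_k) : 0 <= dot x x.
Proof. by rewrite dotE sumr_ge0 // => i _; rewrite -expr2 sqr_ge0. Qed.

Lemma dot_gt0 (k : nat) (x : 'cV[R]_k) : x != 0 -> 0 < dot x x.
Proof.
move=> x0; rewrite lt_def dot_ge0 andbT; apply: contra x0.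
rewrite dotE psumr_eq0; last by move=> i _; rewrite -expr2 sqr_ge0.
move=> /allP x0; apply/eqP/matrixP => i j; rewrite ord1 mxE.
by have /= := x0 i (mem_index_enum _); rewrite mulf_eq0 orbb => /eqP.
Qed.

Lemma qform_rank1 (w x : 'cV[R]_n) : qform (w *m w^T) x = dot w x ^+ 2.
Proof.
have -> : qform (w *m w^T) x = dot x w * dot w x.
  by rewrite /qform mulmxA -mulmxA /dot mxE big_ord1.
by rewrite dotC expr2.
Qed.

(** * Positive semidefinite matrices *)

Lemma quadratic_ge0_discr (a b c : R) : 0 <= c ->
  (forall t, 0 <= a + 2%:R * t * b + t ^+ 2 * c) -> b ^+ 2 <= a * c.
Proof.
rewrite le_eqVlt => /predU1P[<-|c_gt0] pos.
  have [->|b0] := eqVneq b 0; first by rewrite mulr0 expr0n.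
  (* At this t the polynomial, of degree one here, takes the value -1. *)
  have := pos (- (a + 1) / (2%:R * b)).
  have -> : a + 2%:R * (- (a + 1) / (2%:R * b)) * b
      + (- (a + 1) / (2%:R * b)) ^+ 2 * 0 = -1 by field.
  lra.
(* The minimiser of the parabola. *)
have := pos (- b / c).
have -> : a + 2%:R * (- b / c) * b + (- b / c) ^+ 2 * c = (a * c - b ^+ 2) / c.
  by field; rewrite gt_eqF.
by rewrite pmulr_lge0 ?invr_gt0 // subr_ge0.
Qed.

Lemma psdmx_CauchySchwarz M x y : psdmx M ->
  bform M x y ^+ 2 <= qform M x * qform M y.
Proof.
move=> [symM posM]; apply: quadratic_ge0_discr => // t.
have := posM (x + t *: y).
rewrite !qform_bform !(bformDl, bformDr, bformZl, bformZr).
rewrite (bformC y x symM) => xty_ge0; apply: etrans xty_ge0.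
by congr (_ <= _); ring.
Qed.

Lemma psdmx_diag_ge0 M i : psdmx M -> 0 <= M i i.
Proof.
by move=> [_ /(_ (delta_mx i 0))]; rewrite qform_bform bform_delta.
Qed.

Lemma psdmx_diag0 M i j : psdmx M -> M j j = 0 -> M i j = 0.
Proof.
move=> psdM Mjj; have := psdmx_CauchySchwarz (delta_mx i 0) (delta_mx j 0) psdM.
rewrite !qform_bform !bform_delta Mjj mulr0 => Mij.
by apply/eqP; rewrite -sqrf_eq0 eq_le Mij sqr_ge0.
Qed.

Lemma mxdot_rank1 P (w : 'cV[R]_n) : mxdot P (w *m w^T) = qform P w.
Proof.
rewrite qform_bform bformE.
apply: eq_bigr => i _; apply: eq_bigr => j _.
by rewrite mxE big_ord1 mxE.
Qed.

Lemma mxdotDr P M N : mxdot P (M + N) = mxdot P M + mxdot P N.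
Proof.
rewrite -big_split; apply: eq_bigr => i _; rewrite -big_split.
by apply: eq_bigr => j _; rewrite mxE mulrDr.
Qed.

Lemma mxdotZr a P M : mxdot P (a *: M) = a * mxdot P M.
Proof.
rewrite mulr_sumr; apply: eq_bigr => i _; rewrite mulr_sumr.
by apply: eq_bigr => j _; rewrite mxE; ring.
Qed.

Lemma mxdotC M N : mxdot M N = mxdot N M.
Proof. by apply: eq_bigr => i _; apply: eq_bigr => j _; rewrite mulrC. Qed.

Lemma mxdotDl M N P : mxdot (M + N) P = mxdot M P + mxdot N P.
Proof. by rewrite !(mxdotC _ P) mxdotDr. Qed.

Lemma mxdotZl a M P : mxdot (a *: M) P = a * mxdot M P.
Proof. by rewrite !(mxdotC _ P) mxdotZr. Qed.

Lemma mxdot0r P : mxdot P 0 = 0.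
Proof. by rewrite -[0 in LHS](scale0r P) mxdotZr mul0r. Qed.

(** One step of a Cholesky factorisation.  Subtracting the rank-one matrix that
    clears row and column i keeps S positive semidefinite, by the
    Cauchy-Schwarz inequality applied to x and the i-th basis vector. *)
Lemma psdmx_deflate S i : psdmx S -> S i i != 0 ->
  psdmx (S - (S i i)^-1 *: (col i S *m (col i S)^T)).
Proof.
move=> psdS Sii0; have [symS _] := psdS.
have Sii_gt0 : 0 < S i i by rewrite lt_def Sii0 psdmx_diag_ge0.
split=> [|x].
  apply/symmetricmxP; rewrite linearB linearZ /= trmx_mul trmxK.
  by move/symmetricmxP: symS => ->.
rewrite qformB qformZ qform_rank1 subr_ge0 mulrC ler_pdivrMr //.
have -> : dot (col i S) x = bform S x (delta_mx i 0).
  rewrite bformC // /bform trmx_delta -rowE /dot tr_col.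
  by move/symmetricmxP: symS => ->.
have := psdmx_CauchySchwarz x (delta_mx i 0) psdS.
by rewrite !qform_bform bform_delta.
Qed.

(** Deflation writes S as a sum of nonnegative multiples of matrices w w^T, and
    <P, w w^T> is the value at w of the form of P.  The recursion is on the
    number of nonzero diagonal entries of S: a vanishing diagonal entry kills
    its row, hence stays zero under deflation, while the pivot becomes zero. *)
Theorem mxdot_psd_ge0 P S : psdmx P -> psdmx S -> 0 <= mxdot P S.
Proof.
move=> [_ posP].
have [k] := ubnP #|[set i | S i i != 0]|.
elim: k S => // k IHk S; rewrite ltnS => ltSk psdS.
have [S0|] := set_0Vmem [set i | S i i != 0].
  suff -> : S = 0 by rewrite mxdot0r.
  apply/matrixP => i j; rewrite mxE; apply: psdmx_diag0 => //.
  by apply/eqP; have := finset.in_set0 j; rewrite -S0 inE => /negbFE.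
case=> i; rewrite inE => Sii0.
set c := (S i i)^-1; set w := col i S.
have -> : S = (S - c *: (w *m w^T)) + c *: (w *m w^T) by rewrite subrK.
have psdS' := psdmx_deflate psdS Sii0.
rewrite mxdotDr mxdotZr mxdot_rank1 addr_ge0 //; last first.
  by rewrite mulr_ge0 ?posP // invr_ge0 psdmx_diag_ge0.
have S'E j h : (S - c *: (w *m w^T)) j h = S j h - c * (S j i * S h i).
  by rewrite !mxE big_ord1 !mxE.
apply: IHk => //; apply: leq_trans ltSk; apply: proper_card.
apply/properP; split.
  apply/fintype.subsetP => j; rewrite !inE S'E; apply: contraNneq => Sjj.
  have Sij := psdmx_diag0 i psdS Sjj.
  have /symmetricmxP/matrixP/(_ i j) := psdS.1; rewrite mxE Sij => ->.
  by rewrite Sjj !mulr0 subrr.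
exists i; first by rewrite inE.
by rewrite inE S'E negbK /c mulrA mulVf // mul1r subrr.
Qed.

(** * The smallest generalized eigenvalue *)

Lemma qform_bounded M :
  exists2 K, 0 < K & forall x, `|qform M x| <= K * dot x x.
Proof.
exists (1 + \sum_i \sum_j `|M i j|) => [|x].
  by rewrite ltr_pwDl // sumr_ge0 // => i _; rewrite sumr_ge0.
have coord i : x i 0 ^+ 2 <= dot x x.
  rewrite dotE (bigD1 i) //= -expr2 lerDl sumr_ge0 // => j _.
  by rewrite -expr2 sqr_ge0.
rewrite mulrDl mul1r ler_wpDl ?dot_ge0 //.
rewrite qform_bform bformE mulr_suml.
apply: le_trans (ler_norm_sum _ _ _) _; apply: ler_sum => i _.
rewrite mulr_suml; apply: le_trans (ler_norm_sum _ _ _) _.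
apply: ler_sum => j _.
rewrite normrM ler_wpM2l // ler_norml.
(* 2 |x_i x_j| <= x_i^2 + x_j^2 *)
by have := coord i; have := coord j; nra.
Qed.

(** Cauchy-Schwarz for the form of M, applied to x and y = M^-1 x, reads
    |x|^4 <= (x^T M x) (x^T M^-1 x), and the last factor is at most a multiple
    of |x|^2.  This replaces the compactness of the unit sphere. *)
Lemma psd_unit_coercive M : psdmx M -> M \in unitmx ->
  exists2 c, 0 < c & forall x, dot x x <= c * qform M x.
Proof.
move=> psdM unitM; have [symM posM] := psdM.
have [K K0 boundK] := qform_bounded (invmx M).
exists K => // x.
have [->|x0] := eqVneq x 0.
  by rewrite /dot mulmx0 mxE mulr_ge0 // ltW.
have xx0 := dot_gt0 x0.
set y := invmx M *m x.
have yMx : bform M x y = dot x x by rewrite bform_dot mulKVmx.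
have yMy : qform M y = qform (invmx M) x.
  rewrite !qform_bform !bform_dot mulKVmx //.
  exact: dotC.
have := psdmx_CauchySchwarz x y psdM; rewrite yMx yMy.
move=> CSxy; rewrite -(ler_pM2r xx0) -expr2; apply: le_trans CSxy _.
rewrite mulrAC [K * _ * _]mulrC ler_wpM2l //.
exact: le_trans (ler_norm _) (boundK x).
Qed.

Lemma singular_kernel M :
  M \notin unitmx -> exists2 v : 'cV[R]_n, v != 0 & M *m v = 0.
Proof.
rewrite unitmxE unitfE negbK -det_tr => /det0P[v v0 vM].
exists v^T; first by rewrite trmx_eq0.
by rewrite -[M]trmxK -trmx_mul vM trmx0.
Qed.

Lemma qform_ker_eq0 M x : M *m x = 0 -> qform M x = 0.
Proof. by rewrite qform_bform bform_dot => ->; rewrite /dot mulmx0 mxE. Qed.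

Definition posdefmx N : Prop :=
  N \is symmetricmx /\ forall x, x != 0 -> 0 < qform N x.

Lemma qform0 M : qform M 0 = 0.
Proof. by rewrite qform_ker_eq0 // mulmx0. Qed.

Lemma posdefmx_psd N : posdefmx N -> psdmx N.
Proof.
move=> [symN posN]; split=> // x.
by have [->|/posN/ltW //] := eqVneq x 0; rewrite qform0.
Qed.

Lemma posdefmx_unit N : posdefmx N -> N \in unitmx.
Proof.
move=> [_ posN]; apply: contraT => /singular_kernel[v v0 /qform_ker_eq0 Nv0].
by have := posN v v0; rewrite Nv0 ltxx.
Qed.

Local Open Scope classical_set_scope.

Definition pencil_psd M N : set R := [set a | psdmx (M - a *: N)].

Lemma psdmxD M N : psdmx M -> psdmx N -> psdmx (M + N).
Proof.
move=> [/symmetricmxP symM posM] [/symmetricmxP symN posN]; split=> [|x].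
  by apply/symmetricmxP; rewrite linearD /= symM symN.
by rewrite qformD addr_ge0.
Qed.

Lemma psdmxZ a M : 0 <= a -> psdmx M -> psdmx (a *: M).
Proof.
move=> a_ge0 [/symmetricmxP symM posM]; split=> [|x].
  by apply/symmetricmxP; rewrite linearZ /= symM.
by rewrite qformZ mulr_ge0.
Qed.

Lemma symmetric_pencil M N a :
  M \is symmetricmx -> N \is symmetricmx -> M - a *: N \is symmetricmx.
Proof.
move=> /symmetricmxP symM /symmetricmxP symN; apply/symmetricmxP.
by rewrite linearB linearZ /= symM symN.
Qed.

Lemma pencil_psd_has_sup M N : (0 < n)%N -> M \is symmetricmx -> posdefmx N ->
  has_sup (pencil_psd M N).
Proof.
move=> n_gt0 symM posdefN; have [symN posN] := posdefN; split.
  have [K K0 boundK] := qform_bounded M.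
  have [c c0 coerN] :=
    psd_unit_coercive (posdefmx_psd posdefN) (posdefmx_unit posdefN).
  exists (- (K * c)); split=> [|x]; first exact: symmetric_pencil.
  rewrite qformB qformZ mulNr opprK.
  have := boundK x; rewrite ler_norml => /andP[le1 _].
  have := ler_wpM2l (ltW K0) (coerN x); rewrite mulrA; lra.
pose v : 'cV[R]_n := delta_mx (Ordinal n_gt0) 0.
have v0 : v != 0.
  apply/eqP => /matrixP/(_ (Ordinal n_gt0) 0)/eqP.
  by rewrite !mxE !eqxx oner_eq0.
exists (qform M v / qform N v) => a [_ /(_ v)].
by rewrite qformB qformZ subr_ge0 ler_pdivlMr // posN.
Qed.

Lemma psdmx_pencil_sup M N : (0 < n)%N -> M \is symmetricmx -> posdefmx N ->
  psdmx (M - sup (pencil_psd M N) *: N).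
Proof.
move=> n_gt0 symM posdefN; have [symN posN] := posdefN.
have [pencil0 _] := pencil_psd_has_sup n_gt0 symM posdefN.
split=> [|x]; first exact: symmetric_pencil.
have [->|/posN Nx] := eqVneq x 0; first by rewrite qform0.
rewrite qformB qformZ subr_ge0 -ler_pdivlMr //.
apply: ge_sup => // a [_ /(_ x)].
by rewrite qformB qformZ subr_ge0 ler_pdivlMr.
Qed.

(** If M - s N were invertible, it would be coercive, hence dominate a positive
    multiple of the bounded form of N, against the maximality of s. *)
Lemma pencil_sup_singular M N : (0 < n)%N -> M \is symmetricmx -> posdefmx N ->
  M - sup (pencil_psd M N) *: N \notin unitmx.
Proof.
move=> n_gt0 symM posdefN; have [symN posN] := posdefN.
have has_supMN := pencil_psd_has_sup n_gt0 symM posdefN.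
apply/negP => unitMN.
have [c c0 coer] :=
  psd_unit_coercive (psdmx_pencil_sup n_gt0 symM posdefN) unitMN.
have [K K0 boundK] := qform_bounded N.
set s := sup _ in unitMN coer *.
have eps0 : 0 < (K * c)^-1 by rewrite invr_gt0 mulr_gt0.
suff : s + (K * c)^-1 <= s by lra.
apply: sup_upper_bound => //; split=> [|x]; first exact: symmetric_pencil.
have := coer x; rewrite !qformB !qformZ => le1.
have := boundK x; rewrite ler_norml => /andP[_ le2].
rewrite mulrDl opprD addrA subr_ge0 mulrC ler_pdivrMr ?mulr_gt0 // mulrC.
by apply: le_trans le2 _; rewrite -mulrA ler_wpM2l // ltW.
Qed.

(** The supremum s of [pencil_psd M N] is an eigenvalue because M - s N is
    singular.  It is the least one: at an eigenvector w for a, the form of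
    M - s N equals (a - s) w^T N w, which is nonnegative. *)
Theorem lambda_minP M N : (0 < n)%N -> M \is symmetricmx -> posdefmx N ->
  psdmx (M - lambda_min M N *: N) /\ gen_eigenvalue M N (lambda_min M N).
Proof.
move=> n_gt0 symM posdefN; have [symN posN] := posdefN.
have psds := psdmx_pencil_sup n_gt0 symM posdefN.
have := pencil_sup_singular n_gt0 symM posdefN.
set s := sup _ in psds * => /singular_kernel[v v0 Mv].
have eig_s : gen_eigenvalue M N s.
  exists v => //; apply/eqP; rewrite -subr_eq0 scalemxAl -mulmxBl; exact/eqP.
have lb_s : lbound [set a | gen_eigenvalue M N a] s.
  move=> a [w w0 Mw]; have := psds.2 w.
  have /qform_ker_eq0 : (M - a *: N) *m w = 0.
    by rewrite mulmxBl Mw scalemxAl subrr.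
  rewrite !qformB !qformZ => /eqP; rewrite subr_eq0 => /eqP ->.
  by rewrite subr_ge0 ler_pM2r // posN.
suff -> : lambda_min M N = s by [].
apply/eqP; rewrite eq_le; apply/andP; split.
  by apply: ge_inf => //; exists s.
by apply: lb_le_inf => //; exists s.
Qed.

End PositiveSemidefinite.

(** * The convexified problem and its semidefinite relaxation *)

Section Gram.
Variables (R : realType) (m n : nat) (A : 'M[R]_(m, n)).

Lemma qform_gram (x : 'cV[R]_n) : qform (A^T *m A) x = dot (A *m x) (A *m x).
Proof. by rewrite /qform /dot trmx_mul !mulmxA. Qed.

Lemma posdefmx_1D_gram : posdefmx (1%:M + A^T *m A).
Proof.
split=> [|x x0].
  by apply/symmetricmxP; rewrite linearD /= trmx1 trmx_mul trmxK.
rewrite qformD qform_gram ltr_pwDl ?dot_ge0 //.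
by rewrite /qform mulmx1 -/(dot x x) dot_gt0.
Qed.

End Gram.

Section Relaxation.
Local Open Scope classical_set_scope.
Variables (R : realType) (n m p : nat).
Variables (Q : 'M[R]_n) (q : 'cV[R]_n) (A : 'M[R]_(m, n)) (b : 'cV[R]_m).
Variables (C : 'M[R]_(p, n)) (d : 'cV[R]_p) (l u : 'cV[R]_n).
Implicit Types (x : 'cV[R]_n) (X : 'M[R]_n) (a : R).

Let N : 'M[R]_n := 1%:M + A^T *m A.

Definition surrogate x X : R :=
  mxdot 1%:M X - dot (l + u) x + dot l u
  + mxdot (A^T *m A) X - dot (2%:R *: (A^T *m b)) x + dot b b.

Definition convexified a x : R :=
  qform (Q + a *: N) x + dot (q - a *: (l + u + 2%:R *: (A^T *m b))) x
  + a * (dot l u + dot b b).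

(** The relaxation with its surrogate inequality moved into the objective, split
    into the part seen at X = x x^T and a remainder linear in X - x x^T. *)
Lemma lagrangianE a x X :
  mxdot Q X + dot q x + a * surrogate x X =
  convexified a x + mxdot (Q + a *: N) (X - x *m x^T).
Proof.
rewrite /convexified /surrogate -mxdot_rank1 -(scaleN1r (x *m x^T)).
rewrite mxdotDr mxdotZr.
rewrite -scaleNr !(dotDl, dotZl) !(mxdotDl, mxdotZl); ring.
Qed.

Lemma surrogate_rank1_update x (v : 'cV[R]_n) a :
  surrogate x (x *m x^T + a *: (v *m v^T)) =
  surrogate x (x *m x^T) + a * qform N v.
Proof.
by rewrite /surrogate /N qformD !mxdotDr !mxdotZr !mxdot_rank1; ring.
Qed.

(** At X = x x^T the surrogate is the sum of the products
    (x_i - l_i)(x_i - u_i), plus |A x - b|^2, which vanishes. *)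
Lemma surrogate_feasible_le0 x : feasible A b C d l u x ->
  surrogate x (x *m x^T) <= 0.
Proof.
move=> [Axb _ box].
have -> : surrogate x (x *m x^T) = \sum_i (x i 0 - l i 0) * (x i 0 - u i 0).
  have Abx : dot (A^T *m b) x = dot b b.
    by rewrite -{3}Axb /dot trmx_mul trmxK mulmxA.
  rewrite /surrogate !mxdot_rank1 qform_gram Axb dotZl Abx.
  rewrite /qform mulmx1 -/(dot x x).
  have -> : \sum_i (x i 0 - l i 0) * (x i 0 - u i 0)
      = dot x x - dot (l + u) x + dot l u.
    rewrite !dotE -sumrB -big_split; apply: eq_bigr => i _ /=.
    rewrite mxE; ring.
  ring.
apply: sumr_le0 => i _; have /andP[lx xu] := box i.
by rewrite mulr_ge0_le0 ?subr_ge0 ?subr_le0.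
Qed.

(** Weak duality: in [lagrangianE] the penalty term is nonpositive and the
    remainder, the inner product of two positive semidefinite matrices,
    nonnegative. *)
Lemma mu_GEIG_le_mu_SDP_GEIG a : 0 <= a -> psdmx (Q + a *: N) ->
  (mu_GEIG Q q A b C d l u a <= mu_SDP_GEIG Q q A b C d l u)%E.
Proof.
move=> a_ge0 psdP; apply: le_ereal_inf_tmp.
move=> _ [[x X] [feasx _ psdX surr_le0] <-].
apply: (@le_trans _ _ (convexified a x)%:E).
  by apply: ereal_inf_lbound; exists x.
rewrite lee_fin /=; have := lagrangianE a x X.
have := mxdot_psd_ge0 psdP psdX; have := mulr_ge0_le0 a_ge0 surr_le0.
rewrite -/(surrogate x X); lra.
Qed.

(** Adding to x x^T a multiple of v v^T, with v in the kernel of Q + a N, makes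
    the surrogate inequality tight at no cost in the remainder term, so every
    value of the convexified objective at a feasible point is attained in the
    relaxation. *)
Lemma mu_SDP_GEIG_le_mu_GEIG a (v : 'cV[R]_n) :
  v != 0 -> (Q + a *: N) *m v = 0 ->
  (mu_SDP_GEIG Q q A b C d l u <= mu_GEIG Q q A b C d l u a)%E.
Proof.
move=> v0 Pv0; apply: le_ereal_inf_tmp => _ [x feasx <-].
have Nv_gt0 : 0 < qform N v by have [_] := posdefmx_1D_gram A; apply.
(* The step along v v^T at which the surrogate reaches 0. *)
pose t := - surrogate x (x *m x^T) / qform N v.
have t_ge0 : 0 <= t.
  by rewrite divr_ge0 ?(ltW Nv_gt0) // oppr_ge0 surrogate_feasible_le0.
pose X := x *m x^T + t *: (v *m v^T).
have X_sub : X - x *m x^T = t *: (v *m v^T) by rewrite addrC addKr.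
have surrX : surrogate x X = 0.
  by rewrite surrogate_rank1_update /t divfK ?gt_eqF // subrr.
have objX : mxdot Q X + dot q x = convexified a x.
  have := lagrangianE a x X.
  by rewrite surrX X_sub mxdotZr mxdot_rank1 (qform_ker_eq0 Pv0) !mulr0 !addr0.
rewrite -/(convexified a x) -objX.
apply: ereal_inf_lbound; exists (x, X) => //; split=> //.
- by apply/symmetricmxP; rewrite linearD linearZ /= !trmx_mul !trmxK.
- rewrite X_sub; split=> [|y].
    by apply/symmetricmxP; rewrite linearZ /= trmx_mul trmxK.
  by rewrite qformZ qform_rank1 mulr_ge0 ?sqr_ge0.
- by rewrite -/(surrogate x X) surrX.
Qed.

End Relaxation.

(** In dimension 0 every form is zero; the dimension must be positive for the
    set of generalized eigenvalues to be nonempty. *)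
Lemma indefinite_dim_gt0 (R : realType) (n : nat) (M : 'M[R]_n) :
  indefinite M -> (0 < n)%N.
Proof.
case: n M => // M [symM npsd _]; case: npsd; split=> // x.
by rewrite [x]flatmx0 qform0.
Qed.

Theorem proposition5 (R : realType) (n m p : nat)
    (Q : 'M[R]_n) (q : 'cV[R]_n) (A : 'M[R]_(m, n)) (b : 'cV[R]_m)
    (C : 'M[R]_(p, n)) (d : 'cV[R]_p) (l u : 'cV[R]_n)
    (Qsym : Q \is symmetricmx)
    (lu : forall i, l i 0 < u i 0)
    (Qindef : indefinite Q)
    (alpha : R) (alpha_ge0 : 0 <= alpha) :
  (- lambda_min Q (1%:M + A^T *m A) <= alpha ->
     (mu_GEIG Q q A b C d l u alpha <= mu_SDP_GEIG Q q A b C d l u)%E)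
  /\
  (alpha = - lambda_min Q (1%:M + A^T *m A) ->
     mu_GEIG Q q A b C d l u alpha = mu_SDP_GEIG Q q A b C d l u).
Proof.
set N := 1%:M + A^T *m A; set lam := lambda_min Q N.
have posdefN : posdefmx N := posdefmx_1D_gram A.
have [psd_lam [v v0 Qv]] :=
  lambda_minP (indefinite_dim_gt0 Qindef) Qsym posdefN.
have psdP : - lam <= alpha -> psdmx (Q + alpha *: N).
  move=> lam_le; have -> : Q + alpha *: N = Q - lam *: N + (lam + alpha) *: N.
    by rewrite scalerDl addrA subrK.
  apply: psdmxD => //; apply: psdmxZ; last exact: posdefmx_psd.
  by rewrite addrC -lerBlDr sub0r.
split=> [lam_le|alphaE]; first exact/mu_GEIG_le_mu_SDP_GEIG/psdP.
apply/eqP; rewrite eq_le; apply/andP; split.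
  by apply: mu_GEIG_le_mu_SDP_GEIG => //; apply: psdP; rewrite alphaE.
apply: (@mu_SDP_GEIG_le_mu_GEIG _ _ _ _ _ _ _ _ _ _ _ _ _ v) => //.
by rewrite alphaE scaleNr mulmxBl Qv scalemxAl subrr.
Qed.
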